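(* As $n\to\infty$, the total variation distance between the distribution of $X_n$ and that of the binomial random variable $Y_\lambda$ satisfies $$d_{\mathrm{TV}}(\mathscr{L}(X_n),\mathscr{L}(Y_\lambda))=\frac{\sqrt{2}\,|F(\log_2 n)|}{\sqrt{\pi\log_2 n}}+O\left((\log n)^{-1}\right),$$ where $F$ is the bounded function of period $1$ (that is, $F(x+1)=F(x)$) defined for $x\in[0,1)$ by $$F(x)=2^{-x}\sum_{j\ge1}2^{-d_j}\left(j-1-\frac{d_j}{2}\right),$$ when writing $2^x=\sum_{j\ge1}2^{-d_j}\in[1,2)$ with integers $0=d_1<d_2<\cdots$ (the binary expansion of $2^x$, a finite sum if $2^x$ is a dyadic rational; the sum defining $F(x)$ runs over the same indices $j$).
   Context: $X_n$ is the number of 1s in the binary representation of an integer chosen uniformly at random from $\{0,1,\ldots,n-1\}$; $\lambda=\lfloor\log_2 n\rfloor$; $Y_\lambda\sim\mathrm{Binom}(\lambda,1/2)$. For integer-valued random variables $Z,W$, $d_{\mathrm{TV}}(\mathscr{L}(Z),\mathscr{L}(W))=\frac12\sum_{k}|\mathbb{P}(Z=k)-\mathbb{P}(W=k)|$. *)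

(* Defs.v *)
From HB Require Import structures.
From mathcomp Require Import all_boot all_order all_algebra.
From mathcomp Require Import all_classical all_reals all_analysis.
From mathcomp Require Import lra.

Set Implicit Arguments.
Unset Strict Implicit.
Unset Printing Implicit Defensive.

Import Order.TTheory GRing.Theory Num.Theory.
Import numFieldNormedType.Exports.

Local Open Scope classical_set_scope.
Local Open Scope ring_scope.

(* Bits of index i >= k are never set, as k < 2 ^ k. *)
Definition binary_ones (k : nat) : nat :=
  #|[set i : 'I_k | odd (k %/ 2 ^ i)]|.

Lemma measurable_binary_ones : measurable_fun [set: nat] binary_ones.
Proof. by []. Qed.

HB.instance Definition _ :=
  @isMeasurableFun.Build _ _ nat nat binary_ones measurable_binary_ones.

(* The normalized counting measure on {0, ..., n - 1}; for n = 0, where there is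
   nothing to normalize, it is by convention the Dirac measure at 0. *)
Definition uniform_below (R : realType) (n : nat) : probability nat R :=
  mnormalize (mrestr (@counting nat R) (I : measurable `I_n)) \d_0%N.

Lemma uniform_belowE (R : realType) (n k : nat) : (0 < n)%N ->
  uniform_below R n [set k] = (if (k < n)%N then n%:R^-1 else 0 : R)%:E.
Proof.
move=> n0; rewrite /uniform_below /= /mnormalize /= /mrestr setTI.
have cI : @counting nat R `I_n = n%:R%:E.
  rewrite /counting asboolT; last exact: finite_II.
  by rewrite fset_set_II finmap.card_imfset/= ?size_enum_ord//; exact: val_inj.
rewrite cI eqe pnatr_eq0 gtn_eqF//=.
case: ifPn => kn.
  rewrite (_ : _ `&` _ = [set k]); last first.
    by rewrite setIidl// => _ /= ->.
  rewrite /counting asboolT; last exact: finite_set1.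
  by rewrite fset_set1 finmap.cardfs1 mul1e.
rewrite (_ : _ `&` _ = set0) ?measure0 ?mul0e//.
by apply/seteqP; split=> // j /= [->]; rewrite (negbTE kn).
Qed.

Definition X (R : realType) (n : nat) : {RV (uniform_below R n) >-> nat} :=
  binary_ones.

(* Both laws of interest are carried by the natural numbers, so the sum over
   the integers reduces to a sum over nat. *)
Definition dTV (R : realType) (mu nu : probability nat R) : R :=
  2^-1 * fine (\sum_(0 <= k <oo) `|mu [set k] - nu [set k]|)%E.

Definition log2 (R : realType) (x : R) : R := ln x / ln 2.

Definition lambda (R : realType) (n : nat) : nat :=
  Num.truncn (log2 (n%:R : R)).

Definition dyadic (R : realType) (y : R) : Prop :=
  exists m k : nat, y = m%:R / 2 ^+ k.

(* Indices start at 0: [d j] is Some d_{j+1}, or None when the expansion has at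
   most j terms. *)
Definition binary_expansion (R : realType) (y : R) (d : nat -> option nat) :=
  [/\ d 0%N = Some 0%N,
      forall j b, d j.+1 = Some b -> exists2 a, d j = Some a & (a < b)%N,
      series (fun j => oapp (fun a => 2 ^- a : R) 0 (d j)) @ \oo --> y &
      dyadic y -> exists j, d j = None].

(* Existence and uniqueness of the expansion, for y in [1, 2), are
   [binary_expansion_exists] and [binary_expansion_unique] below. *)
Definition exponents (R : realType) (y : R) : nat -> option nat :=
  xget (fun=> None) [set d | binary_expansion y d].

(* F on [0, 1); as indices start at 0, the factor j - 1 - d_j / 2 becomes
   j - d_{j+1} / 2. *)
Definition F01 (R : realType) (x : R) : R :=
  2 `^ (- x) * limn (series (fun j =>
    oapp (fun a => 2 ^- a * (j%:R - a%:R / 2) : R) 0 (exponents (2 `^ x) j))).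

Definition F (R : realType) (x : R) : R := F01 (x - (Num.floor x)%:~R).

Section binary_expansions.
Context {R : realType}.
Implicit Types (y r : R) (d : nat -> option nat).

Let w (o : option nat) : R := oapp (fun a => 2 ^- a : R) 0 o.

Let w_ge0 o : 0 <= w o.
Proof. by case: o => //= a; rewrite invr_ge0 exprn_ge0. Qed.

Let pow2V_gt0 a : 0 < 2 ^- a :> R.
Proof. by rewrite invr_gt0 exprn_gt0. Qed.

Let pow2VS a : 2 ^- a = 2 * 2 ^- a.+1 :> R.
Proof. by rewrite exprS invfM mulrA mulfV ?mul1r// pnatr_eq0. Qed.

Let ler_pow2V a b : (a <= b)%N -> 2 ^- b <= 2 ^- a :> R.
Proof.
by move=> ab; rewrite lef_pV2 ?posrE ?exprn_gt0// ler_eXn2l// ltr1n.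
Qed.

Let ltr_pow2V a b : (2 ^- b < 2 ^- a :> R) = (a < b)%N.
Proof. by rewrite ltf_pV2 ?posrE ?exprn_gt0// ltr_eXn2l// ltr1n. Qed.

Let pow2V_small r : 0 < r -> exists a, 2 ^- a <= r.
Proof.
move=> r0; have [a ar] : exists a : nat, r^-1 < a%:R.
  by exists (Num.truncn r^-1).+1; exact: truncnS_gt.
exists a; rewrite -[leRHS]invrK lef_pV2 ?posrE ?invr_gt0 ?exprn_gt0//.
by rewrite (le_trans (ltW ar))// -natrX ler_nat ltnW// ltn_expl.
Qed.

Let greedy r : option nat :=
  if pselect (exists a, 2 ^- a <= r) is left h then Some (ex_minn h) else None.

Let leads r (o : option nat) : Prop :=
  if o is Some a then is_true (2 ^- a <= r < 2 * 2 ^- a) else r = 0.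

Let greedyP r : 0 <= r -> r < 2 ->
  leads r (greedy r).
Proof.
move=> r0 r2; rewrite /leads /greedy; case: pselect => [h|h]; last first.
  apply/eqP; rewrite eq_le r0 andbT leNgt; apply/negP => /pow2V_small.
  exact: h.
case: ex_minnP => a ar amin; rewrite ar/=.
case: a ar amin => [|a] ar amin; first by rewrite expr0 invr1 mulr1.
by rewrite -pow2VS ltNge; apply/negP => /amin; rewrite ltnn.
Qed.

Let rem y : nat -> R := fix rem j :=
  if j is j'.+1 then rem j' - w (greedy (rem j')) else y.

Let remP y : 1 <= y < 2 -> forall j, 0 <= rem y j < 2.
Proof.
move=> /andP[y1 y2]; elim=> [|j /andP[r0 r2]] /=.
  by rewrite y2 (le_trans ler01 y1).
have := greedyP r0 r2; rewrite /leads; case: greedy => [a /andP[ar _]|->] /=.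
  by rewrite subr_ge0 ar/= (le_lt_trans _ r2)// gerBl ltW.
by rewrite subr0 lexx ltr0n.
Qed.

Lemma binary_expansion_exists y :
  1 <= y < 2 -> exists d, binary_expansion y d.
Proof.
move=> y12; have [y1 y2] := andP y12.
pose d j := greedy (rem y j).
have dP j : leads (rem y j) (d j).
  by have /andP[r0 r2] := remP y12 j; exact: greedyP.
have d0 : d 0%N = Some 0%N.
  have := dP 0%N; rewrite /leads.
  case: (d 0%N) => [a /= /andP[ay ya]|/= y0]; last first.
    by move: y1; rewrite y0 ler10.
  case: a ay ya => // a _; rewrite -pow2VS => /(le_lt_trans y1).
  by rewrite -[ltLHS]invr1 -(expr0 2) ltr_pow2V.
have dS j b : d j.+1 = Some b -> exists2 a, d j = Some a & (a < b)%N.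
  move=> djb; have := dP j.+1; rewrite /leads djb => /andP[br _].
  have := dP j; rewrite /leads; case E: (d j) => [a|] rj.
    exists a => //; rewrite -ltr_pow2V; apply: (le_lt_trans br) => /=.
    rewrite -/(d j) E/=; move: rj => /andP[_]; lra.
  move: br; rewrite /= -/(d j) E/= rj subr0.
  by rewrite leNgt pow2V_gt0.
have d_ge j a : d j = Some a -> (j <= a)%N.
  elim: j a => // j IH b /dS[a /IH ja ab]; exact: leq_ltn_trans ja ab.
have T_rem j : series (fun i => w (d i)) j = y - rem y j.
  elim: j => [|j IH]; first by rewrite seriesEnat/= big_geq// subrr.
  by rewrite seriesSr IH /= -/(d j); lra.
have rem_lt j : rem y j <= 2 * 2 ^- j.
  have := dP j; rewrite /leads; case E: (d j) => [a|] => [/andP[_ ra]|->].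
    by apply: (le_trans (ltW ra)); rewrite ler_pM2l// ler_pow2V// d_ge.
  by rewrite mulr_ge0// ltW.
have rem0 : rem y @ \oo --> (0 : R).
  apply: (@squeeze_cvgr _ _ _ _ (fun=> 0) (fun j => 2 * 2^-1 ^+ j)).
  - near=> j; rewrite exprVn rem_lt andbT.
    by have /andP[] := remP y12 j.
  - exact: cvg_cst.
  - rewrite -[X in _ --> X](mulr0 2); apply: cvgM; first exact: cvg_cst.
    by apply: cvg_expr; rewrite ger0_norm; lra.
exists d; split => //.
- rewrite (_ : series _ = fun j => y - rem y j); last exact/funext.
  by rewrite -[X in _ --> X]subr0; apply: cvgB => //; exact: cvg_cst.
- move=> [m [k yE]].
  have remE j : exists n : nat, rem y j = n%:R / 2 ^+ k.
    elim: j => [|j [n rn]]; first by exists m.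
    have := dP j; rewrite /leads /= -/(d j).
    case E: (d j) => [a|] /=; last first.
      by exists n; rewrite subr0.
    move=> /andP[ar _]; have n0 : (0 < n)%N.
      rewrite lt0n; apply/eqP => n0; move: ar.
      by rewrite rn n0 mul0r leNgt pow2V_gt0.
    have ak : (a <= k)%N.
      have := dP j; rewrite /leads E => /andP[_ ra].
      have : 2 ^- k < 2 * 2 ^- a :> R.
        apply: le_lt_trans ra; rewrite rn -[leLHS]mul1r ler_pM2r//.
        by rewrite ler1n.
      case: (a) => // a'; rewrite -pow2VS.
      by rewrite ltr_pow2V.
    have aE : 2 ^- a = (2 ^ (k - a))%:R / 2 ^+ k :> R.
      apply/(mulIf (x := 2 ^+ k)); first by rewrite expf_neq0// pnatr_eq0.
      rewrite divfK ?expf_neq0 ?pnatr_eq0// -{1}(subnK ak) exprD mulrCA.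
      by rewrite mulVf ?expf_neq0 ?pnatr_eq0// mulr1 natrX.
    exists (n - 2 ^ (k - a))%N; rewrite natrB; first by rewrite rn aE mulrBl.
    by move: ar; rewrite rn aE ler_pM2r// ler_nat.
  exists k.+1; case E: (d k.+1) => [b|//].
  have kb := d_ge _ _ E.
  have := dP k.+1; rewrite /leads E => /andP[br rb].
  have [n rn] := remE k.+1.
  have n0 : (0 < n)%N.
    rewrite lt0n; apply/eqP => n0; move: br.
    by rewrite rn n0 mul0r leNgt pow2V_gt0.
  have : 2 ^- k < 2 * 2 ^- b :> R.
    apply: le_lt_trans rb; rewrite rn -[leLHS]mul1r ler_pM2r//.
    by rewrite ler1n.
  by case: (b) kb => // b' kb; rewrite -pow2VS ltr_pow2V ltnNge -ltnS kb.
Unshelve. all: by end_near. Qed.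

Let S d := series (fun j => w (d j)).

Let S_S d j : S d j.+1 = S d j + w (d j).
Proof. by rewrite /S seriesSr addrC. Qed.

Let none_stays d l :
  (forall j b, d j.+1 = Some b -> exists2 a, d j = Some a & (a < b)%N) ->
  d l = None -> forall m, d (l + m)%N = None.
Proof.
move=> dS dl; elim=> [|m IHm]; first by rewrite addn0.
by rewrite addnS; case E: (d _) => [c|//]; have [c'] := dS _ _ E; rewrite IHm.
Qed.

Let S_none y d l : binary_expansion y d -> d l = None -> y <= S d l.
Proof.
move=> [_ dS dy _] dl; apply: (cvgr_to_le dy); exists l => // n /= ln.
rewrite -(subnKC ln) -[leLHS]/(S d _).
elim: (n - l)%N => [|m IHm]; first by rewrite addn0.
by rewrite addnS S_S (none_stays dS dl) addr0.
Qed.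

Let dyadicD y a : dyadic y -> dyadic (y + 2 ^- a).
Proof.
move=> [m [k ->]]; exists (m * 2 ^ a + 2 ^ k)%N, (k + a)%N.
have H n : 2 ^+ n != 0 :> R by rewrite expf_neq0// pnatr_eq0.
rewrite natrD natrM !natrX exprD; apply/(mulIf (mulf_neq0 (H k) (H a))).
by rewrite divfK ?mulf_neq0// mulrDl mulrA divfK//
  [X in _ + X]mulrCA mulVf// mulr1.
Qed.

Let tail_le y d l a : binary_expansion y d -> d l = Some a ->
  y - S d l.+1 <= 2 ^- a.
Proof.
move=> [_ dS dy _] dla.
have H N : forall l' a', d l' = Some a' ->
    S d (l'.+1 + N)%N - S d l'.+1 <= 2 ^- a'.
  elim: N => [|N IH] l' a' dl'; first by rewrite addn0 subrr ltW.
  have := S_S d l'.+1; case E: (d l'.+1) => [b|] /= SE.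
    have [a'' + ab] := dS _ _ E; rewrite dl' => -[a''E].
    have := IH _ _ E; rewrite addSnnS; have := pow2VS a'.
    by have := @ler_pow2V a'.+1 b; rewrite a''E => /(_ ab); lra.
  have dN := none_stays dS E.
  suff -> : S d (l'.+1 + N.+1)%N = S d l'.+1 by rewrite subrr ltW.
  by elim: N.+1 => [|m IHm]; [rewrite addn0|rewrite addnS S_S dN addr0].
rewrite lerBlDr; apply: (cvgr_to_le dy); exists l.+1 => // n /= ln.
by rewrite -lerBlDr -(subnKC ln) H.
Qed.

Let tail_ge y d l : binary_expansion y d -> S d l <= y.
Proof.
move=> [_ _ dy _]; apply: (cvgr_to_ge dy); exists l => // n /= ln.
rewrite -(subnKC ln); elim: (n - l)%N => [|m IHm]; first by rewrite addn0.
by rewrite addnS; apply: (le_trans IHm); rewrite -[leRHS]/(S d _) S_S lerDl.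
Qed.

Let partial_dyadic d l : dyadic (S d l).
Proof.
elim: l => [|l IHl].
  by exists 0%N, 0%N; rewrite /S seriesEnat/= big_geq// mul0r.
by rewrite S_S; case: (d l) => [a|] /=; [exact: dyadicD|rewrite addr0].
Qed.

Let tail_lt y d l a : binary_expansion y d -> d l = Some a ->
  y - S d l.+1 < 2 ^- a.
Proof.
move=> dE dla; rewrite lt_neqAle (tail_le dE dla) andbT; apply/eqP => yE.
have [_ dS _ fin] := dE.
have H N : exists2 b, d (l + N)%N = Some b & y - S d (l + N).+1 = 2 ^- b.
  elim: N => [|N [b db yb]]; first by exists a; rewrite addn0.
  rewrite addnS; case E: (d (l + N).+1) => [c|]; last first.
    by have := S_none dE E; move: (pow2V_gt0 b) yb; lra.
  exists c => //; have [b' + bc] := dS _ _ E; rewrite db => -[b'E].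
  move: bc; rewrite -b'E => /ler_pow2V bc.
  have := tail_le dE E; have := S_S d (l + N).+1; rewrite E /=.
  by have := pow2VS b; lra.
have [|j dj] := fin.
  have -> : y = S d l.+1 + 2 ^- a by lra.
  exact/dyadicD/partial_dyadic.
have dN := none_stays dS dj.
by have [b] := H j; rewrite addnC dN.
Qed.

Lemma binary_expansion_unique y d d' :
  binary_expansion y d -> binary_expansion y d' -> d = d'.
Proof.
move=> dE dE'.
have eP e : binary_expansion y e -> forall l, leads (y - S e l) (e l).
  move=> eE l; rewrite /leads; case E: (e l) => [a|].
    have := tail_lt eE E; have := tail_ge l.+1 eE; rewrite S_S E /=.
    by move=> ? ?; apply/andP; split; lra.
  by have := S_none eE E; have := tail_ge l eE; lra.
have det r a b : 2 ^- a <= r < 2 * 2 ^- a -> 2 ^- b <= r < 2 * 2 ^- b ->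
    (b <= a)%N.
  move=> /andP[ar _] /andP[_ rb]; case: b rb => // b; rewrite -pow2VS => rb.
  by rewrite -ltr_pow2V; exact: le_lt_trans rb.
apply/funext => l; suff [//] : d l = d' l /\ S d l = S d' l.
have step k : S d k = S d' k -> d k = d' k.
  move=> Sk; have := eP _ dE k; have := eP _ dE' k; rewrite Sk /leads.
  case: (d k) => [a|]; case: (d' k) => [b|] //.
  - move=> hb ha; congr Some; apply/eqP.
    by rewrite eqn_leq (det _ _ _ hb ha) (det _ _ _ ha hb).
  - by move=> -> /andP[]; rewrite leNgt pow2V_gt0.
  - by move=> /andP[+ _] => /[swap] ->; rewrite leNgt pow2V_gt0.
elim: l => [|l [dl Sl]].
  by split; rewrite ?step// /S !seriesEnat/= !big_geq.
have SE : S d l.+1 = S d' l.+1 by rewrite !S_S dl Sl.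
by split => //; exact: step.
Qed.

Lemma exponentsP y : 1 <= y < 2 -> binary_expansion y (exponents y).
Proof. by move=> /binary_expansion_exists ?; exact: xgetPex. Qed.

End binary_expansions.

(* Main.v *)
Require Import Defs.
From mathcomp Require Import all_boot all_order all_algebra.
From mathcomp Require Import all_classical all_reals all_analysis.
From mathcomp Require Import ring lra zify.

(** Encode a law on the natural numbers by its generating polynomial; total
variation is then half of the l1 norm of the coefficients of a difference, and
this norm is submultiplicative. With h = (1 + X) / 2, the law Binom(m, 1/2) is
h ^ m.

Write n as the sum of the 2 ^ e_j, where l = e_0 > e_1 > ... and d_j = l - e_j.
The integers below n split into one block of size 2 ^ e_j for each j: those
that agree with n above position e_j, where n has j ones, and have the digit 0
there, so that the remaining e_j digits are free. Hence the law of X_n is the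
mixture of the laws X ^ j * h ^ (l - d_j) with weights w_j = 2 ^ e_j / n
(weight_poly_blocks). Expanding at X = 1, where X - 1 plays the part of a finite
difference,
  X ^ j * h ^ (l - d) - h ^ l
    = (j - d / 2) (X - 1) h ^ l + (X - 1) ^ 2 h ^ (l - d) S,
with the norm of S at most quadratic in d (shift_estimate). The weighted sum of
the factors j - d_j / 2 is exactly F (log2 n) (F_log2), because 2 to the
fractional part of log2 n is n / 2 ^ l. As w_j decays geometrically in d_j, the
remainders add up to O(1 / l) once (X - 1) ^ 2 h ^ m has norm O(1 / m)
(weight_poly_estimate).

Binomial coefficients are unimodal, so (X - 1) h ^ m has norm twice the largest
coefficient of h ^ m, called peak m. Wallis's recursion encloses the square of
peak m between 2 / (pi (m + 2)) and 2 / (pi m). This gives the O(1 / m) above,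
by writing (X - 1) ^ 2 h ^ m as a product of two first differences, and also
peak l = sqrt 2 / sqrt (pi log2 n) + O(1 / l) (peak_asymptotics). So the
distance is |F (log2 n)| * peak l + O(1 / l), which is the claim. *)

Set Implicit Arguments.
Unset Strict Implicit.
Unset Printing Implicit Defensive.

Import Order.TTheory GRing.Theory Num.Theory.
Import numFieldNormedType.Exports.

Local Open Scope classical_set_scope.
Local Open Scope ring_scope.

(** * The l1 norm on polynomials *)

Section l1norm.
Context {R : realFieldType}.
Implicit Types (p q g : {poly R}) (c a : R).

Definition l1norm p : R := \sum_(i < size p) `|p`_i|.

Lemma l1normE N p : (size p <= N)%N -> l1norm p = \sum_(i < N) `|p`_i|.
Proof.
move=> pN; rewrite /l1norm (big_ord_widen N (fun i => `|p`_i|))//.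
rewrite big_mkcond; apply: eq_bigr => i _; case: ltnP => // pi.
by rewrite nth_default// normr0.
Qed.

Lemma l1norm_ge0 p : 0 <= l1norm p.
Proof. exact: sumr_ge0. Qed.

Lemma l1normD p q : l1norm (p + q) <= l1norm p + l1norm q.
Proof.
pose N := maxn (size p) (size q).
rewrite (@l1normE N) ?size_polyD// (@l1normE N p) ?leq_maxl//.
rewrite (@l1normE N q) ?leq_maxr// -big_split; apply: ler_sum => i _.
by rewrite coefD ler_normD.
Qed.

Lemma l1normZ c p : l1norm (c *: p) = `|c| * l1norm p.
Proof.
rewrite (@l1normE (size p)) ?size_scale_leq// mulr_sumr.
by apply: eq_bigr => i _; rewrite coefZ normrM.
Qed.

Lemma l1normN p : l1norm (- p) = l1norm p.
Proof. by rewrite -scaleN1r l1normZ normrN1 mul1r. Qed.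

Lemma l1normB p q : l1norm (p - q) <= l1norm p + l1norm q.
Proof. by rewrite -(l1normN q) l1normD. Qed.

Lemma l1norm0 : l1norm 0 = 0.
Proof. by rewrite /l1norm size_poly0 big_ord0. Qed.

Lemma l1norm1 : l1norm 1 = 1.
Proof. by rewrite /l1norm size_poly1 big_ord1 coef1 normr1. Qed.

Lemma l1norm_sum (I : Type) (r : seq I) (P : pred I) (f : I -> {poly R}) :
  l1norm (\sum_(i <- r | P i) f i) <= \sum_(i <- r | P i) l1norm (f i).
Proof.
elim/big_ind2 : _ => [|p x q y px qy|//]; first by rewrite l1norm0.
by rewrite (le_trans (l1normD _ _))// lerD.
Qed.

Lemma l1normXnM i p : l1norm ('X^i * p) = l1norm p.
Proof.
rewrite (@l1normE (i + size p)) ?(leq_trans (size_polyMleq _ _)) ?size_polyXn//.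
rewrite big_split_ord/= big1 ?add0r.
  by apply: eq_bigr => j _; rewrite coefXnM ltnNge leq_addr addnC addnK.
by move=> j _; rewrite coefXnM ltn_ord normr0.
Qed.

Lemma l1normM p q : l1norm (p * q) <= l1norm p * l1norm q.
Proof.
rewrite -[p in p * q]coefK poly_def mulr_suml mulr_suml.
apply: le_trans (l1norm_sum _ _ _) _; apply: ler_sum => i _.
by rewrite -scalerAl l1normZ l1normXnM.
Qed.

Lemma l1norm_exp p n : l1norm p <= 1 -> l1norm (p ^+ n) <= 1.
Proof.
move=> p1; elim: n => [|n IH]; first by rewrite expr0 l1norm1.
by rewrite exprS (le_trans (l1normM _ _))// mulr_ile1 ?l1norm_ge0.
Qed.

Lemma l1normX : l1norm 'X = 1.
Proof. by rewrite -['X]mulr1 -['X]expr1 l1normXnM l1norm1. Qed.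

(** The generating polynomial of a fair coin in {0, 1}. *)
Definition fair_bit : {poly R} := 2^-1 *: (1 + 'X).

Lemma fair_bitE : fair_bit = 1 + 2^-1 *: ('X - 1).
Proof.
rewrite /fair_bit !scalerDr scalerN addrCA addrC; congr (_ + _).
by apply/eqP; rewrite -subr_eq opprK -scalerDl -div1r -splitr scale1r.
Qed.

Lemma l1norm_fair_bit : l1norm fair_bit <= 1.
Proof.
rewrite /fair_bit l1normZ ger0_norm ?invr_ge0// ler_pdivrMl// mulr1.
by apply: le_trans (l1normD _ _) _; rewrite l1norm1 l1normX.
Qed.

(** The geometric sum gives g ^ d - 1 = (g - 1) * sum_(l < d) g ^ l, and each
power of g has norm at most 1. *)
Lemma exp_taylor1 g a d : g = 1 + a *: ('X - 1) -> l1norm g <= 1 ->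
  exists2 T, g ^+ d = 1 + ('X - 1) * T & l1norm T <= `|a| * d%:R.
Proof.
move=> gE g1; exists (a *: \sum_(l < d) g ^+ l).
  rewrite -scalerAr scalerAl.
  have -> : a *: ('X - 1) = g - 1 by rewrite gE [1 + _]addrC addrK.
  by rewrite -subrX1 addrC subrK.
rewrite l1normZ ler_wpM2l//; apply: le_trans (l1norm_sum _ _ _) _.
rewrite -[d in d%:R]card_ord -sum1_card natr_sum.
by apply: ler_sum => i _; exact: l1norm_exp.
Qed.

(** Induction on d: passing from g ^ d to g ^ d.+1 adds a *: T to the remainder,
with T the first order remainder, whose norm grows linearly. This form serves
both g = 'X (a = 1) and g = fair_bit (a = 1/2). *)
Lemma exp_taylor2 g a d : g = 1 + a *: ('X - 1) -> l1norm g <= 1 -> `|a| <= 1 ->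
  exists2 S, g ^+ d = 1 + (d%:R * a) *: ('X - 1) + ('X - 1) ^+ 2 * S
    & l1norm S <= d%:R ^+ 2.
Proof.
move=> gE g1 a1; elim: d => [|d [S SE S1]].
  exists 0; last by rewrite l1norm0 expr2 mul0r.
  by rewrite mul0r scale0r mulr0 !addr0.
have [T TE T1] := exp_taylor1 d gE g1.
exists (S + a *: T).
  rewrite exprS {1}gE mulrDl mul1r {1}SE TE -!mul_polyC -natr1.
  rewrite !rmorphM !rmorphD/=.
  ring.
apply: le_trans (l1normD _ _) _; rewrite l1normZ.
have : `|a| * l1norm T <= d%:R.
  apply: (@le_trans _ _ (1 * (1 * d%:R))); last by rewrite !mul1r.
  apply: ler_pM => //; first exact: l1norm_ge0.
  by apply: le_trans T1 _; rewrite ler_wpM2r.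
rewrite -natr1; have : 0 <= d%:R :> R by []. nra.
Qed.

(** Replacing d fair bits by the constant i changes the law of m + d fair bits
by the change of mean i - d / 2 times a first difference, up to second
differences. Both 'X ^ i and fair_bit ^ d are expanded to second order at
'X = 1; the linear term comes out multiplied by fair_bit ^ m, and turning this
factor into fair_bit ^ (m + d) costs one more multiple of 'X - 1. *)
Lemma shift_estimate (i d m : nat) : (i <= d)%N ->
  l1norm ('X^i * fair_bit ^+ m - fair_bit ^+ (m + d)
          - (i%:R - d%:R / 2) *: (('X - 1) * fair_bit ^+ (m + d)))
  <= 3 * d%:R ^+ 2 * l1norm (('X - 1) ^+ 2 * fair_bit ^+ m).
Proof.
move=> id.
have X1 : 'X = 1 + 1 *: ('X - 1) :> {poly R} by rewrite scale1r addrC subrK.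
have [|||S SE S1] := @exp_taylor2 'X 1 i; rewrite ?l1normX ?normr1//.
have n2 : `|2^-1 : R| <= 1 by rewrite ger0_norm ?invr_ge0// invf_le1// ler1n.
have [S' SE' S1'] := exp_taylor2 d fair_bitE l1norm_fair_bit n2.
have [T TE T1] := exp_taylor1 d fair_bitE l1norm_fair_bit.
set c := i%:R - d%:R / 2.
have -> : 'X^i * fair_bit ^+ m - fair_bit ^+ (m + d)
    - c *: (('X - 1) * fair_bit ^+ (m + d))
  = (S - S' - c *: T) * (('X - 1) ^+ 2 * fair_bit ^+ m).
  rewrite exprD SE {1}SE' TE /c -!mul_polyC !(rmorphB, rmorphM) /=; ring.
apply: le_trans (l1normM _ _) _; apply: ler_wpM2r; first exact: l1norm_ge0.
apply: le_trans (l1normB _ _) _; rewrite l1normZ.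
have := l1normB S S'.
have id' : i%:R <= d%:R :> R by rewrite ler_nat.
have i0 : 0 <= i%:R :> R by [].
have cd : `|c| <= d%:R by rewrite ler_norml /c; apply/andP; split; lra.
have : `|c| * l1norm T <= d%:R * d%:R.
  apply: ler_pM => //; first exact: l1norm_ge0.
  apply: le_trans T1 _; rewrite ler_piMl//.
nra.
Qed.
End l1norm.

(** * First differences of the binomial law *)

Section peak.
Context {R : realFieldType}.
Implicit Types (m k : nat).

Definition peak m : R := 'C(m, m./2)%:R / 2 ^+ m.

Lemma coef_fair_bitX m k :
  ((fair_bit : {poly R}) ^+ m)`_k = 'C(m, k)%:R / 2 ^+ m.
Proof.
rewrite /fair_bit exprZn coefZ exprVn mulrC; congr (_ / _).
rewrite (_ : (1 + 'X) ^+ m = \poly_(i < m.+1) 'C(m, i)%:R :> {poly R}).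
  by rewrite coef_poly ltnS; case: leqP => // /bin_small ->.
rewrite exprDn poly_def; apply: eq_bigr => i _.
by rewrite expr1n mul1r scaler_nat.
Qed.

Lemma size_fair_bitX m : (size ((fair_bit : {poly R}) ^+ m) <= m.+1)%N.
Proof.
apply/leq_sizeP => k mk; rewrite coef_fair_bitX bin_small// mul0r//.
Qed.

Lemma leq_bin_half m k :
  if (k < m./2)%N then ('C(m, k) <= 'C(m, k.+1))%N
  else ('C(m, k.+1) <= 'C(m, k))%N.
Proof.
have E := mul_bin_left m k; case: ifP => km.
  by rewrite -(leq_pmul2l (ltn0Sn k)) E leq_mul2r; apply/orP; right; lia.
by rewrite -(leq_pmul2l (ltn0Sn k)) E leq_mul2r; apply/orP; right; lia.
Qed.

(** The coefficients of (X - 1) h ^ m are the increments of a sequence that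
climbs from 0 to peak m and then descends back to 0, so their absolute values
telescope on each side of the mode. *)
Lemma l1norm_diff_fair_bit m :
  l1norm (('X - 1) * (fair_bit : {poly R}) ^+ m) = 2 * peak m.
Proof.
(* The coefficients of h ^ m, shifted by one and preceded by the value 0. *)
pose u k : R := if k is k'.+1 then 'C(m, k')%:R / 2 ^+ m else 0.
have uE k : (('X - 1) * (fair_bit : {poly R}) ^+ m)`_k = u k - u k.+1.
  rewrite mulrBl mul1r coefB coefXM coef_fair_bitX.
  by case: k => [|k] /=; rewrite coef_fair_bitX.
have u_up k : (k < (m./2).+1)%N -> u k <= u k.+1.
  case: k => [|k] km; rewrite /u /= ?divr_ge0 ?exprn_ge0//.
  rewrite ler_pM2r ?invr_gt0 ?exprn_gt0// ler_nat.
  by have := leq_bin_half m k; rewrite (_ : (k < m./2)%N).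
have u_down k : ((m./2).+1 <= k)%N -> u k.+1 <= u k.
  case: k => [|k] km //; rewrite /u /=.
  rewrite ler_pM2r ?invr_gt0 ?exprn_gt0// ler_nat.
  by have := leq_bin_half m k; rewrite ltnNge -ltnS km.
rewrite (@l1normE _ m.+2); last first.
  apply: leq_trans (size_polyMleq _ _) _.
  by rewrite size_XsubC; apply: size_fair_bitX.
rewrite -(big_mkord xpredT (fun i => `|_`_i|)).
rewrite (big_cat_nat (n := (m./2).+1))//=; last lia.
rewrite (eq_big_nat _ _ (F2 := fun i => u i.+1 - u i)); last first.
  by move=> k /andP[_ km]; rewrite uE distrC ger0_norm// subr_ge0 u_up.
rewrite telescope_sumr//.
rewrite [X in _ + X](eq_big_nat _ _ (F2 := fun i => - (u i.+1 - u i))).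
  rewrite sumrN telescope_sumr; last lia.
  by rewrite /u /peak (@bin_small m m.+1)//; lra.
move=> k /andP[mk _]; rewrite uE opprB ger0_norm// subr_ge0; exact: u_down.
Qed.

End peak.

(** * Wallis's bounds on the central binomial coefficient *)

Section wallis.
Context {R : realType}.

(** A primitive of cos ^ n, given by the reduction formula that integration by
parts yields. It makes the integral of cos ^ n over [0, pi / 2] a difference of
two values, so that no integration theory enters. *)
Fixpoint cos_primitive (n : nat) : R -> R :=
  if n is n'.+1 then
    if n' is n''.+1 then
      fun x => n%:R^-1 * (sin x * cos x ^+ n' + n'%:R * cos_primitive n'' x)
    else sin
  else id.

Lemma is_derive_cos_primitive n (x : R) :
  is_derive x (1 : R) (cos_primitive n) (cos x ^+ n).
Proof.
elim/ltn_ind: n => -[|[|n]] IH.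
- by rewrite expr0; exact: is_derive_id.
- by rewrite expr1; exact: is_derive_sin.
have dn := IH n (ltnW (ltnSn _)).
pose f : R -> R :=
  n.+2%:R^-1 \*: (sin * (cos ^+ n.+1) + n.+1%:R \*: cos_primitive n).
have -> : cos_primitive n.+2 = f.
  by apply/funext => y; rewrite /f /= !fctE.
have dM := is_deriveM (is_derive_sin x) (is_deriveX n.+1 (is_derive_cos x)).
have df := is_deriveZ n.+2%:R^-1 (is_deriveD dM (is_deriveZ n.+1%:R dn)).
apply: is_derive_eq df _; rewrite !fctE/=.
have s2 : sin x ^+ 2 = 1 - cos x ^+ 2 by rewrite -(cos2Dsin2 x) addrC addKr.
rewrite /GRing.scale/=.
have n0 : n.+2%:R != 0 :> R by [].
apply: (mulfI n0); rewrite mulVKf//.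
have -> : sin x * (n.+1%:R * cos x ^+ n * - sin x) =
  - (n.+1%:R * cos x ^+ n * sin x ^+ 2) by ring.
rewrite s2 !exprS -!natr1; ring.
Qed.

(** The integral of cos ^ n over [0, pi / 2]. *)
Definition wallis n : R := cos_primitive n (pi / 2) - cos_primitive n 0.

Lemma wallis0 : wallis 0 = pi / 2.
Proof. by rewrite /wallis /= subr0. Qed.

Lemma wallis1 : wallis 1 = 1.
Proof. by rewrite /wallis /= sin_pihalf sin0 subr0. Qed.

Lemma wallisSS n : n.+2%:R * wallis n.+2 = n.+1%:R * wallis n.
Proof.
rewrite /wallis /= cos_pihalf sin0 !expr0n/= mulr0 mul0r !add0r.
by rewrite -mulrBr mulVKf// mulrBr.
Qed.

(** The difference of the two primitives has derivative
cos ^ n - cos ^ n.+1, which is nonnegative on [0, pi / 2]. *)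
Lemma wallis_decreasing n : wallis n.+1 <= wallis n.
Proof.
pose f := cos_primitive n - cos_primitive n.+1.
have df x : is_derive x (1 : R) f (cos x ^+ n - cos x ^+ n.+1).
  by apply: is_deriveB; exact: is_derive_cos_primitive.
have cf : {within `[0, pi / 2], continuous f}.
  by apply: derivable_within_continuous => x _; have [] := df x.
have pi2 : 0 <= pi / 2 :> R by rewrite divr_ge0 ?pi_ge0.
have [c c01] := MVT_segment pi2 (fun x _ => df x) cf.
move=> E; move: c01; rewrite in_itv/= => /andP[c0 cpi].
have cc : 0 <= cos c <= 1.
  rewrite cos_le1 andbT cos_ge0_pihalf// cpi andbT (le_trans _ c0)//.
  by rewrite oppr_le0 divr_ge0// pi_ge0.
have : 0 <= f (pi / 2) - f 0.
  rewrite E mulr_ge0// ?subr0 ?divr_ge0 ?pi_ge0// subr_ge0 exprS.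
  by case/andP: cc => c0' c1; rewrite ler_piMl// exprn_ge0.
by rewrite /f /wallis !fctE; lra.
Qed.

(** By the reduction formula, the left-hand side is independent of n. *)
Lemma wallis_prod n : n.+1%:R * wallis n.+1 * wallis n = pi / 2.
Proof.
elim: n => [|n IH]; first by rewrite wallis0 wallis1 !mul1r.
by rewrite wallisSS mulrAC.
Qed.

Lemma peak_odd k : k.*2.+2%:R * peak k.*2.+1 = k.*2.+1%:R * peak k.*2 :> R.
Proof.
rewrite /peak [_.+1./2](_ : _ = k); last lia.
rewrite doubleK; have := mul_bin_down k.*2.+1 k.
rewrite (_ : k.*2.+1 - k = k.+1)%N /=; last lia.
move=> /(congr1 (fun n => n%:R : R)); rewrite !natrM exprS => E.
rewrite [RHS]mulrA E invfM !mulrA; congr (_ / _).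
rewrite [_ * _ / 2]mulrAC; congr (_ * _).
by rewrite (_ : k.*2.+2 = (k.+1 * 2)%N) ?natrM ?mulfK//; lia.
Qed.

Lemma peak_even k : peak k.*2.+2 = peak k.*2.+1 :> R.
Proof.
rewrite /peak (_ : k.*2.+2./2 = k.+1)%N; last lia.
rewrite (_ : k.*2.+1./2 = k); last lia.
rewrite binS -(bin_sub (m := k.+1)); last lia.
rewrite (_ : k.*2.+1 - k.+1 = k)%N; last lia.
rewrite addnn -mul2n natrM [2 ^+ _.+2]exprS invfM mulrACA.
by rewrite divff ?mul1r.
Qed.

Lemma wallis_peak k : wallis k.*2 = pi / 2 * peak k.*2.
Proof.
elim: k => [|k IH]; first by rewrite wallis0 /peak expr0 bin0 divr1 mulr1.
have n0 : k.*2.+2%:R != 0 :> R by [].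
apply: (mulfI n0); rewrite doubleS wallisSS IH peak_even [RHS]mulrCA peak_odd.
by rewrite mulrCA.
Qed.

(** In the constant product of two consecutive Wallis integrals, monotonicity
bounds the odd one by the even one from either side. *)
Lemma peak_sqr_double k :
  (k.*2%:R * pi * peak k.*2 ^+ 2 <= 2 :> R) /\
  (2 <= k.*2.+1%:R * pi * peak k.*2 ^+ 2 :> R).
Proof.
have pi0 := pi_gt0 R.
have p0 : 0 <= peak k.*2 :> R by rewrite /peak divr_ge0 ?exprn_ge0.
have wE := wallis_peak k.
have w0 : 0 <= wallis k.*2 by rewrite wE mulr_ge0// divr_ge0// ltW.
have H (c : R) :
    c * pi * peak k.*2 ^+ 2 * (pi / 2 ^+ 2) = c * wallis k.*2 * wallis k.*2.
  by rewrite wE; field.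
have c0 : 0 < pi / 2 ^+ 2 :> R by rewrite divr_gt0.
have piE : 2 * (pi / 2 ^+ 2) = pi / 2 :> R by field.
split; rewrite -(ler_pM2r c0) H piE.
  case: k {p0 wE H} w0 => [|k] w0; first by rewrite !mul0r divr_ge0// ltW.
  rewrite -(wallis_prod k.*2.+1) -doubleS.
  apply: ler_wpM2l; first by rewrite mulr_ge0.
  by rewrite doubleS; exact: wallis_decreasing.
rewrite -(wallis_prod k.*2); apply: ler_wpM2r => //; apply: ler_wpM2l => //.
exact: wallis_decreasing.
Qed.

(** An odd m has the same peak as m.+1, hence the loss from m.+1 to m.+2 in the
lower bound. *)
Lemma peak_sqr_bounds m :
  (m%:R * pi * peak m ^+ 2 <= 2 :> R) /\ (2 <= m.+2%:R * pi * peak m ^+ 2 :> R).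
Proof.
have mon (a b : nat) (c : R) :
    (a <= b)%N -> a%:R * pi * c ^+ 2 <= b%:R * pi * c ^+ 2.
  move=> ab; rewrite ler_wpM2r ?sqr_ge0// ler_wpM2r ?pi_ge0// ler_nat//.
have [mE|mE] : m = (m./2).*2 \/ m = ((m./2).*2.+1) by lia.
  have [h1 h2] := peak_sqr_double m./2; rewrite -mE in h1 h2; split => //.
  by apply: le_trans h2 _; apply: mon.
have [] := peak_sqr_double (m./2).+1; rewrite doubleS peak_even -mE => h1 h2.
split; last by apply: le_trans h2 _; apply: mon; lia.
by apply: le_trans h1; apply: mon; lia.
Qed.

Lemma peak_ge0 m : 0 <= peak m :> R.
Proof. by rewrite /peak divr_ge0 ?exprn_ge0. Qed.

Lemma peak_sqr_le m : peak m ^+ 2 <= 2 / m.+1%:R :> R.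
Proof.
case: m => [|m]; first by rewrite /peak expr0 bin0 !divr1 expr1n ler1n.
have [+ _] := peak_sqr_bounds m.+1; rewrite ler_pdivlMr// => H.
apply: le_trans H; rewrite mulrC; apply: ler_wpM2r; first exact: sqr_ge0.
have := pi_ge2 R => p2; apply: (@le_trans _ _ (m.+1%:R * 2)).
  by rewrite -natrM ler_nat; lia.
by rewrite ler_wpM2l.
Qed.

(** Sharing the m fair bits evenly between two first differences, each of norm
O(m ^ (-1/2)), gives one over m. *)
Lemma l1norm_diff2_fair_bit m :
  l1norm (('X - 1) ^+ 2 * (fair_bit : {poly R}) ^+ m) <= 16 / m.+1%:R.
Proof.
have mE : m = (m./2 + (m - m./2))%N by lia.
have -> : ('X - 1) ^+ 2 * (fair_bit : {poly R}) ^+ m =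
  (('X - 1) * fair_bit ^+ m./2) * (('X - 1) * fair_bit ^+ (m - m./2)).
  by rewrite {1}mE exprD; ring.
apply: le_trans (l1normM _ _) _; rewrite !l1norm_diff_fair_bit.
have H k : (m <= k.*2.+1)%N -> peak k ^+ 2 <= 4 / m.+1%:R :> R.
  move=> mk; apply: le_trans (peak_sqr_le k) _.
  rewrite ler_pdivrMr// mulrAC ler_pdivlMr// -!natrM ler_nat; lia.
have H1 := H m./2 ltac:(lia); have H2 := H (m - m./2)%N ltac:(lia).
have -> : 16 / m.+1%:R = 4 * (4 / m.+1%:R) :> R by ring.
set t := 4 / _ in H1 H2 *; set a := peak _ in H1 *; set b := peak _ in H2 *.
have : 0 <= (a - b) ^+ 2 by rewrite sqr_ge0.
nra.
Qed.
End wallis.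

(** * Binary digits and dyadic blocks *)

Lemma binary_onesE N k : (k <= N)%N ->
  binary_ones k = (\sum_(0 <= i < N) odd (k %/ 2 ^ i))%N.
Proof.
move=> kN; have -> : binary_ones k = (\sum_(0 <= i < k) odd (k %/ 2 ^ i))%N.
  rewrite /binary_ones -sum1_card big_mkcond big_mkord; apply: eq_bigr => i _.
  rewrite (_ : (i \in _) = odd (k %/ 2 ^ i)); first by case: odd.
  by apply/idP/idP; rewrite inE.
rewrite [RHS](big_cat_nat (n := k))//= [X in (_ + X)%N]big_nat_cond.
rewrite [X in (_ + X)%N]big1 ?addn0// => i /andP[/andP[ki _] _].
by rewrite divn_small// (leq_ltn_trans ki)// ltn_expl.
Qed.

Lemma binary_ones_double (b : bool) m :
  binary_ones (b + m.*2) = (b + binary_ones m)%N.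
Proof.
rewrite (@binary_onesE (b + m.*2).+1)// big_nat_recl// expn0 divn1.
rewrite oddD odd_double addbF oddb; congr (_ + _)%N.
rewrite (@binary_onesE (b + m.*2) m); last lia.
apply: eq_big_nat => i _; rewrite expnS divnMA.
congr (nat_of_bool (odd (_ %/ _)))%N.
by rewrite divn2 half_bit_double.
Qed.

Section weight_poly.
Context {R : realFieldType}.

(** n times the generating polynomial of the law of X_n. *)
Definition weight_poly n : {poly R} := \sum_(0 <= i < n) 'X^(binary_ones i).

Lemma weight_polyS n : weight_poly n.+1 = weight_poly n + 'X^(binary_ones n).
Proof. by rewrite /weight_poly big_nat_recr. Qed.

Lemma weight_poly_double m : weight_poly m.*2 = (1 + 'X) * weight_poly m.
Proof.
elim: m => [|m IH]; first by rewrite /weight_poly !big_geq// mulr0.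
rewrite doubleS !weight_polyS IH.
have -> : binary_ones m.*2 = binary_ones m.
  by rewrite (binary_ones_double false).
have -> : binary_ones m.*2.+1 = (binary_ones m).+1.
  by rewrite (binary_ones_double true).
by rewrite exprS; ring.
Qed.

(** The decreasing list e of the positions of the ones of n governs the law of
X_n. Induction on the number of digits: doubling shifts every position and
multiplies the polynomial by 1 + X, as the last digit is free; an odd n has one
more position, 0, and one more integer below it, n.-1, whose ones are those of
n./2. *)
Lemma weight_poly_blocks n : exists e : seq nat,
  [/\ sorted gtn e, n = (\sum_(a <- e) 2 ^ a)%N, size e = binary_ones n,
      (0 < n -> 2 ^ head 0 e <= n < 2 ^ (head 0 e).+1)%N &
      weight_poly n = \sum_(0 <= j < size e) 'X^j * (1 + 'X) ^+ nth 0%N e j].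
Proof.
elim/ltn_ind: n => n IH; have [->|n0] := posnP n.
  exists [::]; split => //; rewrite ?big_nil//.
    by rewrite (binary_onesE (N := 0)) ?big_geq.
  by rewrite /weight_poly !big_geq.
have [e [se ne ze he we]] := IH n./2 ltac:(lia).
have mE : weight_poly (n./2).*2
    = \sum_(0 <= j < size e) 'X^j * (1 + 'X) ^+ nth 0%N (map S e) j.
  rewrite weight_poly_double we mulr_sumr; apply: eq_big_nat => j /andP[_ je].
  by rewrite mulrCA (nth_map 0%N)// exprS.
have sumE : (\sum_(a <- map S e) 2 ^ a = (n./2).*2)%N.
  rewrite big_map ne -mul2n big_distrr/=; apply: eq_bigr => a _.
  by rewrite expnS.
have sE : sorted gtn (map S e) by rewrite sorted_map.
have hE : (0 < n./2 -> 2 ^ (head 0 e).+1 <= n < 2 ^ (head 0 e).+2)%N.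
  by move=> /he; rewrite !expnS; set p := (2 ^ _)%N; lia.
have nE : n = (odd n + (n./2).*2)%N by rewrite odd_double_half.
case: (boolP (odd n)) nE => on nE.
  exists (rcons (map S e) 0%N); split.
  - rewrite -rev_sorted rev_rcons /= path_sortedE; last first.
      by move=> x y z xy yz; exact: ltn_trans xy yz.
    rewrite rev_sorted sE andbT; apply/allP => x; rewrite mem_rev.
    by move=> /mapP[y _ ->].
  - by rewrite big_rcons/= sumE {1}nE; lia.
  - by rewrite size_rcons size_map ze [in RHS]nE (binary_ones_double true).
  - move=> _; case: e ne he hE {we ze se mE sumE sE} => [|a e] /= ne he hE.
      by rewrite big_nil in ne; rewrite nE ne.
    apply: hE; rewrite ne big_cons addn_gt0 expn_gt0//.
  - rewrite [in LHS]nE weight_polyS mE size_rcons size_map big_nat_recr//=.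
    rewrite nth_rcons size_map ltnn eqxx expr0 mulr1.
    have -> : binary_ones (n./2).*2 = size e.
      by rewrite (binary_ones_double false) ze.
    congr (_ + _); apply: eq_big_nat => j /andP[_ je].
    by rewrite nth_rcons size_map je.
exists (map S e); split => //.
- by rewrite sumE {1}nE; lia.
- by rewrite size_map ze [in RHS]nE (binary_ones_double false).
- move=> _; case: e ne he hE {we ze se mE sumE sE} => [|a e] /= ne he hE.
    by move: n0; rewrite big_nil in ne; rewrite nE ne.
  apply: hE; rewrite ne big_cons addn_gt0 expn_gt0//.
- by rewrite [in LHS]nE size_map mE.
Qed.
End weight_poly.

(** * Laws as polynomials *)

Section laws.
Context {R : realType}.

Lemma counting_below n (A : set nat) :
  @counting nat R (A `&` `I_n) = (\sum_(0 <= i < n) (i \in A)%:R)%:E.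
Proof.
have c1 k : @counting nat R [set k] = 1%E.
  by rewrite /counting asboolT ?fset_set1 ?finmap.cardfs1//; exact: finite_set1.
elim: n => [|n IH]; first by rewrite II0 setI0 measure0 big_geq.
rewrite big_nat_recr//= EFinD -IH IIS setIUr measureU//; last first.
  by apply/seteqP; split => // x [[_ /=]] xn [_ /= xE]; rewrite xE ltnn in xn.
congr (_ + _)%E; case: (boolP (n \in A)) => nA.
  rewrite setIidr; last by move=> x ->; rewrite inE in nA.
  exact: c1.
rewrite (_ : _ `&` _ = set0) ?measure0//.
apply/seteqP; split=> // x [/= + xE]; rewrite xE => /mem_set.
by rewrite (negbTE nA).
Qed.

Lemma uniform_below_set n (A : set nat) : (0 < n)%N ->
  uniform_below R n A = (n%:R^-1 * \sum_(0 <= i < n) (i \in A)%:R)%:E.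
Proof.
move=> n0; rewrite /uniform_below /= /mnormalize /= /mrestr setTI.
have cI : @counting nat R `I_n = n%:R%:E.
  rewrite -[`I_n]setTI counting_below; congr _%:E.
  rewrite (eq_bigr (fun=> 1)); last by move=> i _; rewrite in_setT.
  by rewrite sumr_const_nat subn0.
by rewrite cI eqe pnatr_eq0 gtn_eqF//= counting_below -EFinM mulrC.
Qed.

Lemma distribution_X n k : (0 < n)%N ->
  distribution (uniform_below R n) (X R n) [set k]
  = ((n%:R^-1 *: weight_poly n)`_k)%:E.
Proof.
move=> n0; rewrite [LHS](uniform_below_set _ n0) coefZ /weight_poly coef_sum.
congr (_ * _)%:E; apply: eq_bigr => i _; rewrite coefXn.
congr (nat_of_bool _)%:R.
by apply/idP/eqP; rewrite inE/=.
Qed.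

Lemma binomial_prob_half m k :
  binomial_prob m (2^-1 : R) [set k] = (((fair_bit : {poly R}) ^+ m)`_k)%:E.
Proof.
rewrite /binomial_prob ifT; last by lra.
rewrite esum_set1 ?lee_fin ?binomial_pmf_ge0//; last by lra.
congr _%:E; rewrite /binomial_pmf coef_fair_bitX.
rewrite (_ : unstable.onem 2^-1 = 2^-1 :> R).
  2: by rewrite /unstable.onem; lra.
case: (leqP k m) => km; last by rewrite bin_small// mulr0n mul0r.
by rewrite -exprD subnKC// -mulr_natl exprVn.
Qed.

Lemma dTV_l1norm (mu nu : probability nat R) (p q : {poly R}) :
  (forall k, mu [set k] = (p`_k)%:E) -> (forall k, nu [set k] = (q`_k)%:E) ->
  dTV mu nu = 2^-1 * l1norm (p - q).
Proof.
move=> pE qE; rewrite /dTV; congr (_ * _).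
rewrite (nneseries_split 0 (size (p - q))) => [|k _]; last exact: abse_ge0.
rewrite [X in (_ + X)%E]eseries0 ?adde0.
  rewrite add0n /l1norm -(big_mkord xpredT (fun i => `|(p - q)`_i|)).
  rewrite (eq_bigr (fun i => `|(p - q)`_i|%:E)) ?sumEFin// => i _.
  by rewrite pE qE -EFinB abse_EFin coefB.
move=> k; rewrite add0n => pk _; rewrite pE qE -EFinB abse_EFin -coefB.
by rewrite nth_default// normr0.
Qed.
End laws.

(** * Periodicity and boundedness of F *)

Section Fbound.
Context {R : realType}.
Implicit Types (d : nat -> option nat) (x y : R).

(** The ratio (5 / 4) ^ 3 / 2 left when half of the powers of 2 absorb a cubic
factor; see pow2V_cube_le. *)
Definition decay : R := 125 / 128.

(** The sum of the geometric series 64 * decay ^ j. *)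
Definition cubic_bound : R := 64 * (128 / 3).

Lemma decay_ge0 : 0 <= decay. Proof. by rewrite /decay; lra. Qed.

Lemma decay_le1 : decay <= 1. Proof. by rewrite /decay; lra. Qed.

Lemma cubic_bound_ge0 : 0 <= cubic_bound.
Proof. by rewrite /cubic_bound; lra. Qed.

(** Bernoulli's inequality gives a.+1 <= 4 * (5 / 4) ^ a, to be cubed. *)
Lemma pow2V_cube_le a : 2 ^- a * a.+1%:R ^+ 3 <= 64 * decay ^+ a.
Proof.
have bernoulli : 1 + a%:R / 4 <= (5 / 4) ^+ a :> R.
  elim: a => [|a IH]; first by rewrite expr0; lra.
  have : 0 <= a%:R :> R by [].
  by rewrite -natr1 exprS; lra.
have {}bernoulli : a.+1%:R <= 4 * (5 / 4) ^+ a :> R.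
  by rewrite -natr1; lra.
have decayE : decay = 2^-1 * (5 / 4) ^+ 3 by rewrite /decay; lra.
have -> : 64 * decay ^+ a = 2 ^- a * (4 * (5 / 4) ^+ a) ^+ 3.
  rewrite [(4 * _) ^+ 3]exprMn -exprM mulnC exprM mulrCA -exprVn -exprMn.
  by rewrite decayE; congr (_ * _); lra.
apply: ler_wpM2l; first by rewrite invr_ge0 exprn_ge0.
by rewrite lerXn2r ?nnegrE ?mulr_ge0 ?exprn_ge0 ?divr_ge0.
Qed.

Lemma sum_decay_le n : 64 * \sum_(0 <= j < n) decay ^+ j <= cubic_bound.
Proof.
rewrite /cubic_bound ler_wpM2l//.
suff -> : \sum_(0 <= j < n) decay ^+ j = 128 / 3 * (1 - decay ^+ n).
  by rewrite ler_piMr// gerBl exprn_ge0// decay_ge0.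
elim: n => [|n IH]; first by rewrite big_geq// expr0 subrr mulr0.
rewrite big_nat_recr//= IH exprS; move: (decay ^+ n) => t.
by rewrite /decay; lra.
Qed.

Lemma decay_anti i j : (i <= j)%N -> decay ^+ j <= decay ^+ i.
Proof.
by move=> ij; apply: ler_wiXn2l => //; rewrite ?decay_ge0 ?decay_le1.
Qed.

(** With a j = d_j, this bounds the remainders summed over the blocks of n, up
to a constant multiple of 1 / (l + 1). *)
Lemma sum_pow2V_cube_le n (a : nat -> nat) :
  (forall j, (j < n)%N -> (j <= a j)%N) ->
  \sum_(0 <= j < n) 2 ^- a j * (a j).+1%:R ^+ 3 <= cubic_bound.
Proof.
move=> ja; apply: le_trans (sum_decay_le n).
rewrite mulr_sumr; apply: ler_sum_nat => j /andP[_ jn].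
apply: le_trans (pow2V_cube_le _) _.
by rewrite ler_wpM2l// decay_anti// ja.
Qed.

Definition excess_term d (j : nat) : R :=
  oapp (fun a => 2 ^- a * (j%:R - a%:R / 2)) 0 (d j).

(** For j <= a the factor j - a / 2 lies in [- a, a]; the cubic bound is far
from tight but is at hand. *)
Lemma excess_term_le d j :
  (forall a, d j = Some a -> (j <= a)%N) ->
  `|excess_term d j| <= 64 * decay ^+ j.
Proof.
rewrite /excess_term; case: (d j) => [a|] /= ja; last first.
  by rewrite normr0 mulr_ge0// exprn_ge0// decay_ge0.
have {}ja := ja _ erefl.
rewrite normrM ger0_norm ?invr_ge0 ?exprn_ge0//.
apply: (@le_trans _ _ (2 ^- a * a.+1%:R ^+ 3)).
  apply: ler_wpM2l; first by rewrite invr_ge0 exprn_ge0.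
  have j0 : 0 <= j%:R :> R by [].
  have ja' : j%:R <= a%:R :> R by rewrite ler_nat.
  by rewrite ler_norml -natr1; apply/andP; split; nra.
by apply: le_trans (pow2V_cube_le _) _; rewrite ler_wpM2l// decay_anti.
Qed.

Lemma limn_excess_le d : (forall j a, d j = Some a -> (j <= a)%N) ->
  `|limn (series (excess_term d))| <= cubic_bound.
Proof.
move=> dj.
have part n : [normed series (excess_term d)] n <= cubic_bound.
  apply: le_trans (sum_decay_le n); rewrite /series/= mulr_sumr.
  by apply: ler_sum => j _; apply: excess_term_le => a; apply: dj.
have cv : cvgn [normed series (excess_term d)].
  apply: nondecreasing_is_cvgn.
    by apply: nondecreasing_series => j _ _; exact: normr_ge0.
  by exists cubic_bound => _ [n _ <-].
apply: le_trans (lim_series_norm cv) _.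
by apply: limr_le => //; near=> n; exact: part.
Unshelve. all: by end_near. Qed.

Lemma binary_expansion_ge y d j a :
  binary_expansion y d -> d j = Some a -> (j <= a)%N.
Proof.
move=> [_ dS _ _]; elim: j a => // j IH b /dS[a /IH ja ab].
exact: leq_ltn_trans ja ab.
Qed.

Lemma ln2_gt0 : 0 < ln 2 :> R.
Proof. by rewrite ln_gt0// ltr1n. Qed.

Lemma pow2E x : 2 `^ x = expR (x * ln 2) :> R.
Proof. by rewrite /powR pnatr_eq0. Qed.

Lemma F01_bounded x : 0 <= x < 1 -> `|F01 x| <= cubic_bound.
Proof.
move=> /andP[x0 x1].
have y12 : (1 : R) <= 2 `^ x < 2.
  have l2 := ln2_gt0; rewrite pow2E; apply/andP; split.
    by rewrite -[leLHS]expR0 ler_expR mulr_ge0// ltW.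
  by rewrite -[ltRHS](@lnK R) ?posrE// ltr_expR -[ltRHS]mul1r ltr_pM2r.
have dE := exponentsP y12.
rewrite /F01 normrM ger0_norm ?powR_ge0//.
rewrite -[leRHS]mul1r; apply: ler_pM; rewrite ?powR_ge0//.
  by rewrite powRN invf_le1 ?(andP y12).1// powR_gt0.
apply: limn_excess_le => j a; exact: binary_expansion_ge dE.
Qed.

Lemma F_periodic x : F (x + 1) = F x.
Proof.
have floorD1 : Num.floor (x + 1) = Num.floor x + 1.
  by rewrite floorDrz ?rpred1// floor1.
by rewrite /F floorD1 intrD; congr F01; ring.
Qed.

Lemma F_le x : `|F x| <= cubic_bound.
Proof.
apply: F01_bounded; rewrite subr_ge0 floor_le/= ltrBlDl.
by have := floorD1_gt x; rewrite intrD.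
Qed.

Lemma F_bounded : [bounded F x | x in [set: R]].
Proof.
exists cubic_bound; split => [|M BM x _]; first exact: num_real.
by apply: le_trans (F_le _) _; exact: ltW.
Qed.
End Fbound.

(** * The value of F at log2 n *)

Section log2.
Context {R : realType}.
Implicit Types (n l : nat).

Lemma log2_itv n l : (2 ^ l <= n < 2 ^ l.+1)%N ->
  l%:R <= log2 (n%:R : R) < l.+1%:R.
Proof.
move=> /andP[lln nl]; have l2 := @ln2_gt0 R.
have n0 : (0 < n)%N by rewrite (leq_trans _ lln)// expn_gt0.
have lnE k : k%:R * ln 2 = ln ((2 ^ k)%:R) :> R.
  by rewrite natrX lnXn// mulr_natl.
rewrite /log2 ler_pdivlMr// ltr_pdivrMr// !lnE.
rewrite ler_ln ?ltr_ln ?posrE ?ltr0n ?expn_gt0//.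
by rewrite ler_nat ltr_nat lln.
Qed.

Lemma lambdaE n l : (2 ^ l <= n < 2 ^ l.+1)%N -> lambda R n = l.
Proof. by move=> /log2_itv /truncn_def. Qed.

Lemma pow2_frac_log2 n l : (2 ^ l <= n < 2 ^ l.+1)%N ->
  2 `^ (log2 n%:R - (Num.floor (log2 (n%:R : R)))%:~R) = n%:R / 2 ^+ l :> R.
Proof.
move=> nl; have l2 := @ln2_gt0 R.
have -> : Num.floor (log2 (n%:R : R)) = l.
  by apply: floor_def; rewrite intrD -!pmulrn natr1; exact: log2_itv.
have n0 : (0 < n)%N.
  by case/andP: nl => lln _; rewrite (leq_trans _ lln)// expn_gt0.
rewrite powRB ?pnatr_eq0 ?implybT// -pmulrn powR_mulrn//; congr (_ / _).
by rewrite pow2E /log2 divfK ?lt0r_neq0// lnK// posrE ltr0n.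
Qed.

Lemma sorted_gtn_nth e j : sorted gtn e -> (j < size e)%N ->
  (nth 0 e j + j <= head 0 e)%N.
Proof.
move=> se; elim: j => [|j IH] je; first by rewrite nth0 addn0.
have := IH (ltnW je); have := sortedP 0%N se j je; rewrite /=; lia.
Qed.

(** The d_j of the expansion of n / 2 ^ l, when e lists the positions of the
ones of n in decreasing order; l is then the head of e. *)
Definition exponents_of (e : seq nat) (j : nat) : option nat :=
  if (j < size e)%N then Some (head 0 e - nth 0 e j)%N else None.

Lemma pow2V_sub (l a : nat) : (a <= l)%N -> 2 ^- (l - a) = 2 ^+ a / 2 ^+ l :> R.
Proof.
move=> al; apply/(mulIf (x := 2 ^+ l)); first by rewrite expf_neq0// pnatr_eq0.
rewrite divfK ?expf_neq0 ?pnatr_eq0// -{2}(subnK al) exprD mulrA.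
by rewrite mulVf ?mul1r ?expf_neq0 ?pnatr_eq0.
Qed.

Lemma series_exponents_of (f : nat -> nat -> R) e :
  series (fun j => oapp (f j) 0 (exponents_of e j)) @ \oo -->
  \sum_(0 <= j < size e) f j (head 0 e - nth 0 e j)%N.
Proof.
apply: cvg_near_cst; exists (size e) => // k /= ek.
rewrite /series/= (big_cat_nat (n := size e))//= [X in _ + X]big_nat_cond.
rewrite [X in _ + X]big1 ?addr0; last first.
  by move=> i /andP[/andP[ei _] _]; rewrite /exponents_of ltnNge ei.
by apply: eq_big_nat => i /andP[_ ie]; rewrite /exponents_of ie.
Qed.

Lemma binary_expansion_nat n e : (0 < n)%N -> sorted gtn e ->
  n = (\sum_(a <- e) 2 ^ a)%N ->
  binary_expansion (n%:R / 2 ^+ head 0%N e : R) (exponents_of e).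
Proof.
move=> n0 se nE; have e0 : (0 < size e)%N.
  by case: e nE {se} => // nE; move: n0; rewrite nE big_nil.
split.
- by rewrite /exponents_of e0 nth0 subnn.
- move=> j b; rewrite /exponents_of; case: ltnP => // je [<-].
  rewrite (ltnW je); exists (head 0 e - nth 0 e j)%N => //.
  have := sorted_gtn_nth se je; have := sorted_gtn_nth se (ltnW je).
  by have := sortedP 0%N se j je; rewrite /=; lia.
- rewrite [X in _ --> X](_ : _ =
    \sum_(0 <= j < size e) 2 ^- (head 0 e - nth 0 e j)%N).
    exact: (@series_exponents_of (fun _ a => 2 ^- a)).
  rewrite nE natr_sum mulr_suml (big_nth 0%N).
  apply: eq_big_nat => j /andP[_ je].
  rewrite pow2V_sub ?natrX//.
  by have := sorted_gtn_nth se je; lia.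
- by move=> _; exists (size e); rewrite /exponents_of ltnn.
Qed.

(** F (log2 n) is the mean, for the block weights 2 ^ e_j / n, of the shifts of
mean j - d_j / 2: the factor 2 ^ (- x) of F turns 2 ^ - d_j into such a
weight. *)
Lemma F_log2 n e : (0 < n)%N -> sorted gtn e ->
  n = (\sum_(a <- e) 2 ^ a)%N -> (2 ^ head 0 e <= n < 2 ^ (head 0 e).+1)%N ->
  F (log2 (n%:R : R)) =
  \sum_(0 <= j < size e)
    2 ^+ nth 0%N e j / n%:R * (j%:R - (head 0 e - nth 0 e j)%N%:R / 2).
Proof.
move=> n0 se nE nl; rewrite /F /F01 powRN (pow2_frac_log2 nl).
have y12 : 1 <= (n%:R / 2 ^+ head 0%N e : R) < 2.
  case/andP: nl => lln nl.
  have p0 : 0 < 2 ^+ head 0%N e :> R by rewrite exprn_gt0.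
  apply/andP; split; first by rewrite ler_pdivlMr// mul1r -natrX ler_nat.
  by rewrite ltr_pdivrMr// -exprS -natrX ltr_nat.
have dE := binary_expansion_nat n0 se nE.
rewrite (binary_expansion_unique (exponentsP y12) dE).
have cv := @series_exponents_of (fun j a => 2 ^- a * (j%:R - a%:R / 2)) e.
rewrite (cvg_lim _ cv)// mulr_sumr; apply: eq_big_nat => j /andP[_ je].
rewrite pow2V_sub; last by have := sorted_gtn_nth se je; lia.
rewrite mulrA; congr (_ * _).
by rewrite invf_div mulrC mulrA divfK// expf_neq0 ?pnatr_eq0.
Qed.

(** Each block contributes at most w_j * 3 d_j ^ 2 * 16 / (l - d_j + 1).
Bounding 1 / (l - d_j + 1) by (d_j + 1) / (l + 1) treats short and long blocks
alike and leaves the cubic weights summed by sum_pow2V_cube_le. *)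
Lemma weight_poly_estimate n : (0 < n)%N ->
  l1norm (n%:R^-1 *: weight_poly n - fair_bit ^+ lambda R n
          - F (log2 (n%:R : R)) *: (('X - 1) * fair_bit ^+ lambda R n))
  <= 3 * 16 * cubic_bound / (lambda R n).+1%:R.
Proof.
move=> n0; have [e [se nE _ /(_ n0) nl we]] := @weight_poly_blocks R n.
rewrite (F_log2 n0 se nE nl) (lambdaE nl); set l := head 0%N e in nl *.
have nr0 : n%:R != 0 :> R by rewrite pnatr_eq0 -lt0n.
pose d j := (l - nth 0%N e j)%N.
have dE j : (j < size e)%N -> (nth 0 e j + d j)%N = l.
  by move=> je; have := sorted_gtn_nth se je; rewrite /d -/l; lia.
have jd j : (j < size e)%N -> (j <= d j)%N.
  by move=> je; have := sorted_gtn_nth se je; rewrite /d -/l; lia.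
pose w j : R := 2 ^+ nth 0%N e j / n%:R.
have w1 : \sum_(0 <= j < size e) w j = 1.
  rewrite -mulr_suml (_ : \sum_(0 <= j < _) _ = n%:R) ?divff//.
  by rewrite nE natr_sum (big_nth 0%N); apply: eq_bigr => j _; rewrite natrX.
have -> : n%:R^-1 *: weight_poly n - fair_bit ^+ l
   - (\sum_(0 <= j < size e) w j * (j%:R - (d j)%:R / 2))
       *: (('X - 1) * fair_bit ^+ l)
  = \sum_(0 <= j < size e) w j *:
     ('X^j * fair_bit ^+ nth 0%N e j - fair_bit ^+ (nth 0%N e j + d j)
     - (j%:R - (d j)%:R / 2)
         *: (('X - 1) * fair_bit ^+ (nth 0%N e j + d j))).
  rewrite we scaler_sumr scaler_suml.
  (* The weights add up to 1, so h ^ l is its own mixture. *)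
  rewrite [X in _ - X - _](_ : _ = \sum_(0 <= j < size e) w j *: fair_bit ^+ l).
    2: by rewrite -scaler_suml w1 scale1r.
  rewrite -!sumrB.
  apply: eq_big_nat => j /andP[_ je]; rewrite dE// !scalerBr scalerA.
  congr (_ - _ - _); rewrite /w /fair_bit exprZn -!scalerAr scalerA mulrAC.
  by rewrite exprVn divff ?mul1r// expf_neq0 ?pnatr_eq0.
apply: le_trans (l1norm_sum _ _ _) _.
rewrite [leRHS]mulrAC.
apply: (@le_trans _ _ (3 * 16 / l.+1%:R *
    \sum_(0 <= j < size e) 2 ^- d j * (d j).+1%:R ^+ 3)).
  2: by rewrite ler_wpM2l ?divr_ge0 ?mulr_ge0//; exact: sum_pow2V_cube_le.
rewrite mulr_sumr; apply: ler_sum_nat => j /andP[_ je].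
have w0 : 0 <= w j by rewrite divr_ge0// exprn_ge0.
rewrite l1normZ ger0_norm//.
have wd : w j <= 2 ^- d j.
  rewrite pow2V_sub; last by have := dE _ je; lia.
  rewrite /w ler_wpM2l ?exprn_ge0// lef_pV2 ?posrE ?exprn_gt0 ?ltr0n//.
  by rewrite -natrX ler_nat; case/andP: nl.
have est : l1norm (('X - 1) ^+ 2 * (fair_bit : {poly R}) ^+ nth 0%N e j)
    <= 16 * ((d j).+1%:R / l.+1%:R).
  apply: le_trans (l1norm_diff2_fair_bit _) _; rewrite ler_wpM2l//.
  rewrite -[leLHS]div1r ler_pdivrMr// mulrAC ler_pdivlMr// mul1r -natrM ler_nat.
  by have := dE _ je; lia.
have := shift_estimate (nth 0%N e j) (jd _ je) => /= sh.
apply: (@le_trans _ _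
  (2 ^- d j * (3 * (d j).+1%:R ^+ 2 * (16 * ((d j).+1%:R / l.+1%:R))))).
  apply: ler_pM => //; first exact: l1norm_ge0.
  apply: le_trans (sh R) _; apply: ler_pM => //; first exact: l1norm_ge0.
  by rewrite ler_wpM2l// lerXn2r ?nnegrE// ler_nat.
by rewrite le_eqVlt; apply/orP; left; apply/eqP; ring.
Qed.
End log2.

(** * The asymptotic estimate *)

Lemma dist_sqr_le (R : realFieldType) (a b : R) : 0 <= a -> 0 <= b ->
  `|a - b| ^+ 2 <= `|a ^+ 2 - b ^+ 2|.
Proof.
move=> a0 b0; rewrite subr_sqr normrM expr2; apply: ler_wpM2l => //.
by rewrite [leRHS]ger0_norm ?addr_ge0// ler_norml; apply/andP; split; lra.
Qed.

(** The squares of peak l and of sqrt 2 / sqrt (pi x) both lie between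
2 / (pi (l + 2)) and 2 / (pi l), hence differ by O(1 / l ^ 2). Taking square
roots through dist_sqr_le loses nothing that matters, although the true error
is O(l ^ (- 3/2)). *)
Lemma peak_asymptotics (R : realType) (l : nat) (x : R) :
  (0 < l)%N -> l%:R <= x <= l.+1%:R ->
  `|peak l - Num.sqrt 2 / Num.sqrt (pi * x)| <= 2 / l.+1%:R.
Proof.
move=> l0 /andP[lx xl]; have pi0 := pi_gt0 R; have pi2 := pi_ge2 R.
have l0' : 1 <= l%:R :> R by rewrite ler1n.
have x0 : 0 < x by lra.
have T2 : (Num.sqrt 2 / Num.sqrt (pi * x)) ^+ 2 = 2 / (pi * x).
  by rewrite exprMn exprVn !sqr_sqrtr// mulr_ge0// ltW.
have [p1 p2] := @peak_sqr_bounds R l.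
have p0 := @peak_ge0 R l.
have bounds (t : R) : l%:R * pi * t <= 2 -> 2 <= l.+2%:R * pi * t ->
   2 / (pi * l.+2%:R) <= t <= 2 / (pi * l%:R).
  move=> h1 h2; rewrite ler_pdivrMr ?ler_pdivlMr ?mulr_gt0//; last lra.
  by apply/andP; split; lra.
have /andP[a1 a2] := bounds _ p1 p2.
have : 2 / (pi * l.+2%:R) <= 2 / (pi * x) <= 2 / (pi * l%:R).
  apply: bounds.
    by rewrite mulrA ler_pdivrMr ?mulr_gt0//; nra.
  rewrite mulrA ler_pdivlMr ?mulr_gt0// -2!natr1; rewrite -natr1 in xl; nra.
rewrite -T2 => /andP[b1 b2].
rewrite -(@ler_pXn2r _ 2)// ?nnegrE ?divr_ge0//.
have T0 : 0 <= Num.sqrt 2 / Num.sqrt (pi * x) by rewrite divr_ge0 ?sqrtr_ge0.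
apply: (le_trans (dist_sqr_le p0 T0)).
apply: (@le_trans _ _ (2 / (pi * l%:R) - 2 / (pi * l.+2%:R))).
  move: a1 a2 b1 b2; set A := 2 / _; set B := 2 / _; set T := (_ / _) ^+ 2.
  by move=> *; rewrite ler_norml; apply/andP; split; lra.
have -> : 2 / (pi * l%:R) - 2 / (pi * l.+2%:R) = 4 / (pi * l%:R * l.+2%:R) :> R.
  rewrite -2!natr1; field; rewrite !lt0r_neq0//; lra.
rewrite ler_pdivrMr ?mulr_gt0//; last lra.
rewrite expr_div_n mulrAC ler_pdivlMr ?exprn_gt0// -2!natr1.
nra.
Qed.

(** The first difference F *: (X - 1) h ^ l replaces the difference of the two
laws, and then peak l is replaced by its asymptotic value. Both errors are
O(1 / (l + 1)), and l + 1 > log2 n >= ln n. *)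
Lemma dTV_binary_ones (R : realType) n : (1 < n)%N ->
  `|dTV (distribution (uniform_below R n) (X R n))
        (binomial_prob (lambda R n) (2^-1 : R))
    - Num.sqrt 2 * `|F (log2 (n%:R : R))| / Num.sqrt (pi * log2 (n%:R : R))|
  <= (3 * 8 * cubic_bound + cubic_bound * 2) * (ln (n%:R : R))^-1.
Proof.
move=> n1; have n0 : (0 < n)%N := ltnW n1.
have l2 := @ln2_gt0 R.
have l21 : ln 2 <= 1 :> R by apply: (@le_ln1Dx R 1); lra.
have ln0 : 0 < ln (n%:R : R) by rewrite ln_gt0// ltr1n.
have log1 : 1 <= log2 (n%:R : R).
  by rewrite /log2 ler_pdivlMr// mul1r ler_ln ?posrE ?ltr0n// ler_nat.
have /andP[ll lu] : (lambda R n)%:R <= log2 (n%:R : R) < (lambda R n).+1%:R.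
  by rewrite truncn_itv//; lra.
have est := @weight_poly_estimate R n n0.
rewrite (dTV_l1norm (fun k => distribution_X k n0)
                    (fun k => binomial_prob_half _ k)).
set l := lambda R n in ll lu est *.
have l0 : (0 < l)%N.
  rewrite lt0n; apply/eqP => l0; move: lu; rewrite l0; lra.
set x := log2 n%:R in log1 ll lu est *.
set D := _ - fair_bit ^+ l in est *.
have xl : l%:R <= x <= l.+1%:R by rewrite ll ltW.
have pk := peak_asymptotics l0 xl.
set T := Num.sqrt 2 / Num.sqrt (pi * x) in pk.
have -> : Num.sqrt 2 * `|F x| / Num.sqrt (pi * x) = `|F x| * T.
  by rewrite /T mulrAC mulrC.
have lnorm : l1norm (F x *: (('X - 1) * fair_bit ^+ l)) = `|F x| * (2 * peak l).
  by rewrite l1normZ l1norm_diff_fair_bit.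
set B := F x *: _ in est lnorm.
have h1 : l1norm D <= l1norm (D - B) + l1norm B.
  by rewrite -{1}(subrK B D) l1normD.
have h2 : l1norm B <= l1norm (D - B) + l1norm D.
  by rewrite -(l1normN (D - B)) opprB -{1}(subrK D B) l1normD.
have Fl := @F_le R x.
have h3 : `|F x| * `|peak l - T| <= cubic_bound * (2 / l.+1%:R).
  by apply: ler_pM.
have inv : l.+1%:R^-1 <= (ln (n%:R : R))^-1.
  rewrite lef_pV2 ?posrE//; move: lu; rewrite /x /log2 ltr_pdivrMr// => lu.
  by apply: le_trans (ltW lu) _; rewrite ler_piMr.
apply: (@le_trans _ _
  (3 * 8 * cubic_bound / l.+1%:R + cubic_bound * (2 / l.+1%:R))).
  have -> : 2^-1 * l1norm D - `|F x| * T =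
      2^-1 * (l1norm D - l1norm B) + `|F x| * (peak l - T).
    by rewrite lnorm; field.
  apply: le_trans (ler_normD _ _) _.
  apply: lerD; last by rewrite normrM normr_id.
  rewrite normrM ger0_norm ?invr_ge0// ler_pdivrMl//.
  have -> : 2 * (3 * 8 * cubic_bound / l.+1%:R) =
      3 * 16 * cubic_bound / l.+1%:R :> R.
    by ring.
  apply: le_trans est; rewrite ler_norml; apply/andP; split; lra.
rewrite [X in _ + X]mulrA -mulrDl ler_wpM2l//.
by rewrite addr_ge0 ?mulr_ge0 ?cubic_bound_ge0.
Qed.

Theorem corollary2p2 (R : realType) :
  [/\ forall x : R, F (x + 1) = F x,
      [bounded F x | x in [set: R]] &
      (fun n : nat => dTV (distribution (uniform_below R n) (X R n))
                          (binomial_prob (lambda R n) (2^-1 : R))) =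
      (fun n : nat => Num.sqrt 2 * `|F (log2 (n%:R : R))| /
                      Num.sqrt (pi * log2 (n%:R : R)))
      +O_\oo (fun n : nat => (ln (n%:R : R))^-1)].
Proof.
split; [exact: F_periodic|exact: F_bounded|].
apply/eqaddOP; near=> k; near=> n.
have n1 : (1 < n)%N by near: n; exists 2%N.
apply: le_trans (dTV_binary_ones R n1) _.
rewrite [`|(ln _)^-1|]ger0_norm ?invr_ge0 ?ln_ge0 ?ler1n ?(ltnW n1)//.
rewrite ler_wpM2r ?invr_ge0 ?ln_ge0 ?ler1n ?(ltnW n1)//.
Unshelve. all: by end_near. Qed.
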